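(* Let $A, B$ be two real matrices of order $N$ and let $D$ be a full column-rank real matrix of order $N\times M$ with $M\leqslant N$. Let $\mathcal R$ be the composite matrix associated with $(A,B,D)$. Then $\mathrm{Ker}(\mathcal R^T)$ is the largest subspace of all the subspaces of $\mathbb R^N$ which are contained in $\mathrm{Ker}(D^T)$ and invariant for both $A^T$ and $B^T$.
   Context: For non-negative integers $p,q,\dots,r,s$ (a finite sequence of arbitrary length), set $\mathcal R_{(p,q,\dots,r,s)} = A^pB^q\cdots A^rB^sD$, a matrix of order $N\times M$. The composite matrix $\mathcal R=(\mathcal R_{(p,q,\dots,r,s)},\mathcal R_{(p',q',\dots,r',s')},\dots)$ is the enlarged matrix whose block columns are the matrices $\mathcal R_{(p,q,\dots,r,s)}$ for all possible $(p,q,\dots,r,s)$ (finitely many of them suffice to span the same column space). Thus $\mathrm{Im}(\mathcal R)$ is the sum of the images of all $\mathcal R_{(p,q,\dots,r,s)}$, and $\mathrm{Ker}(\mathcal R^T)$ is the set of $x\in\mathbb R^N$ with $D^T(B^T)^s(A^T)^r\cdots(B^T)^q(A^T)^px=0$ for all $(p,q,\dots,r,s)$. A subspace $V$ is invariant for a matrix $K$ if $KV\subseteq V$. *)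

(* Defs.v *)
From HB Require Import structures.
From mathcomp Require Import all_boot all_order all_algebra.
From mathcomp Require Import all_classical all_reals.

Set Implicit Arguments.
Unset Strict Implicit.
Unset Printing Implicit Defensive.

Import GRing.Theory.
Local Open Scope ring_scope.
Local Open Scope classical_set_scope.

(* A^p B^q ... A^r B^s D, the exponents being listed as the pairs
   [:: (p, q); ...; (r, s)]; the empty list gives D, as does [:: (0, 0)]. *)
Definition monomial_mx (R : realType) (N M : nat) (A B : 'M[R]_N)
    (D : 'M[R]_(N, M)) (w : seq (nat * nat)) : 'M[R]_(N, M) :=
  (\prod_(pq <- w) (A ^+ pq.1 * B ^+ pq.2)) *m D.

(* A row of N x M block columns C i; the index type I may be infinite, so this
   is a family rather than an element of a type 'M[R]_(N, K). *)
Definition block_row (R : realType) (N M : nat) (I : Type) : Type :=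
  I -> 'M[R]_(N, M).

Definition composite_mx (R : realType) (N M : nat) (A B : 'M[R]_N)
    (D : 'M[R]_(N, M)) : block_row R N M (seq (nat * nat)) :=
  fun w => monomial_mx A B D w.

(* The transpose of a block row is the block column of the transposes, so its
   kernel consists of the x annihilated by all of the (C i)^T. *)
Definition ker_tr (R : realType) (N M : nat) (I : Type)
    (C : block_row R N M I) : set 'cV[R]_N :=
  [set x | forall i : I, (C i)^T *m x = 0].

Definition kerv (R : realType) (m n : nat) (K : 'M[R]_(m, n)) :
    {vspace 'cV[R]_n} :=
  lker (linfun (mulmx K : 'cV[R]_n -> 'cV[R]_m)).

Definition invariant_subspace (R : realType) (n : nat) (K : 'M[R]_n)
    (V : {vspace 'cV[R]_n}) : Prop :=
  (linfun (mulmx K : 'cV[R]_n -> 'cV[R]_n) @: V <= V)%VS.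

(* The set S is (the carrier of) a subspace satisfying P, and it contains every
   subspace satisfying P. *)
Definition is_largest_subspace (R : realType) (n : nat)
    (P : {vspace 'cV[R]_n} -> Prop) (S : set 'cV[R]_n) : Prop :=
  exists V : {vspace 'cV[R]_n},
    [/\ [set` V] = S, P V & forall W : {vspace 'cV[R]_n}, P W -> (W <= V)%VS].

(* Main.v *)
(** The kernel is cut out by linear conditions, hence is a subspace.  It is
    invariant because [A *m R_w] and [B *m R_w] are again blocks of the
    composite matrix, and it contains every invariant [W <= Ker D^T] because the
    transposed words in [A] and [B] map [W] into itself. *)
Require Import Defs.
From HB Require Import structures.
From mathcomp Require Import all_boot all_order all_algebra.
From mathcomp Require Import all_classical all_reals.

Set Implicit Arguments.
Unset Strict Implicit.
Unset Printing Implicit Defensive.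

Import GRing.Theory.
Local Open Scope ring_scope.

Lemma vspace_of_linear_set (K : fieldType) (vT : vectType K) (S : set vT)
    (S0 : S 0) (SZD : forall (a : K) (u v : vT), S u -> S v -> S (a *: u + v)) :
  exists V : {vspace vT}, [set` V]%classic = S.
Proof.
(* A subspace of maximal dimension among those contained in S is all of S. *)
pose sub_dim n := `[< exists V : {vspace vT},
  \dim V = n /\ forall x, x \in V -> S x >].
have ex0 : exists n, sub_dim n.
  exists 0%N; apply/asboolP; exists 0%VS; split; first exact: dimv0.
  by move=> x; rewrite memv0 => /eqP ->.
have bound n : sub_dim n -> (n <= \dim {:vT})%N.
  by move=> /asboolP[V [<- _]]; exact/dimvS/subvf.
case: (ex_maxnP ex0 bound) => n /asboolP[V [dimV VS]] maxn.
exists V; apply/seteqP; split=> x /=; first exact: VS.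
move=> Sx.
(* Adjoining [x] keeps the subspace inside [S] by [SZD], so maximality of [\dim V] forces [<[x]> +
   V] to equal [V]. *)
have /maxn : sub_dim (\dim (<[x]> + V)%VS).
  apply/asboolP; exists (<[x]> + V)%VS; split=> // y.
  by move=> /memv_addP[_ /vlineP[a ->] [v /VS Sv ->]]; exact: SZD.
rewrite -dimV => le_dim.
have /eqP -> : V == (<[x]> + V)%VS by rewrite eqEdim addvSr le_dim.
by apply: (subvP (addvSl _ _)); exact: memv_line.
Qed.

Lemma mem_kerv (R : realType) (m n : nat) (K : 'M[R]_(m, n)) (x : 'cV[R]_n) :
  (x \in kerv K) = (K *m x == 0).
Proof. by rewrite memv_ker lfunE. Qed.

Lemma invariant_subspaceP (R : realType) (n : nat) (K : 'M[R]_n)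
    (V : {vspace 'cV[R]_n}) :
  invariant_subspace K V <-> forall x, x \in V -> K *m x \in V.
Proof.
split=> [/subvP KV x xV | KV].
  by have := KV _ (memv_img _ xV); rewrite lfunE; apply.
by apply/subvP => _ /memv_imgP[x xV ->]; rewrite lfunE; exact: KV.
Qed.

Section InvariantSubspace.
Variables (R : realType) (n : nat) (V : {vspace 'cV[R]_n}).

Lemma invariant_subspace_tr1 : invariant_subspace (1 : 'M[R]_n)^T V.
Proof. by apply/invariant_subspaceP => x xV; rewrite trmx1 mul1mx. Qed.

(** Transposition reverses the product, so [K^T] acts first and [L^T] second. Keeping the transpose
    outside lets the induction on words run over the untransposed product in [monomial_mx]. *)
Lemma invariant_subspace_trM (K L : 'M[R]_n) :
  invariant_subspace K^T V -> invariant_subspace L^T V ->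
  invariant_subspace (K * L)^T V.
Proof.
move=> /invariant_subspaceP KV /invariant_subspaceP LV.
apply/invariant_subspaceP => x xV.
by rewrite trmx_mul -mulmxA; exact/LV/KV.
Qed.

Lemma invariant_subspace_trX (K : 'M[R]_n) (k : nat) :
  invariant_subspace K^T V -> invariant_subspace (K ^+ k)^T V.
Proof.
move=> KV; elim: k => [|k IHk]; first exact: invariant_subspace_tr1.
by rewrite exprS; exact: invariant_subspace_trM.
Qed.

End InvariantSubspace.

Lemma monomial_mx_cons (R : realType) (N M : nat) (A B : 'M[R]_N)
    (D : 'M[R]_(N, M)) (p q : nat) (w : seq (nat * nat)) :
  monomial_mx A B D ((p, q) :: w) = A ^+ p *m (B ^+ q *m monomial_mx A B D w).
Proof. by rewrite /monomial_mx big_cons !mulmxA. Qed.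

Theorem lemma2p1 (R : realType) (N M : nat) (A B : 'M[R]_N)
    (D : 'M[R]_(N, M)) (leMN : (M <= N)%N) (rankD : \rank D = M) :
  is_largest_subspace
    (fun V : {vspace 'cV[R]_N} =>
       [/\ (V <= kerv D^T)%VS, invariant_subspace A^T V
         & invariant_subspace B^T V])
    (ker_tr (composite_mx A B D)).
Proof.
(* The words form an infinite index type, so the subspace comes from closure under linear
   combinations rather than as the kernel of one matrix. *)
have [|a u v uS vS w|V VS] :=
    @vspace_of_linear_set _ _ (ker_tr (composite_mx A B D)).
- by move=> w; rewrite mulmx0.
- by rewrite mulmxDr -scalemxAr uS vS scaler0 addr0.
have VP x : x \in V <-> forall w, (monomial_mx A B D w)^T *m x = 0.
  by have /(congr1 (fun S => S x)) /= := VS; rewrite /ker_tr /= => ->.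
exists V; split=> //; first split.
(* The empty word contributes the block [D] itself. *)
- apply/subvP => x /VP /(_ [::]).
  by rewrite /monomial_mx big_nil mul1mx mem_kerv => ->.
- apply/invariant_subspaceP => x /VP xV; apply/VP => w.
  (* Prepending [(1, 0)] to [w] multiplies its block by [A ^+ 1 * B ^+ 0], that is, by [A]; below,
     [(0, 1)] does the same for [B]. *)
  by rewrite mulmxA -trmx_mul -(xV ((1, 0)%N :: w)) monomial_mx_cons mul1mx.
- apply/invariant_subspaceP => x /VP xV; apply/VP => w.
  by rewrite mulmxA -trmx_mul -(xV ((0, 1)%N :: w)) monomial_mx_cons mul1mx.
move=> W [/subvP WD WA WB]; apply/subvP => x xW; apply/VP => w.
(* Only the square factor of the block can preserve [W], so [D] is split off; its transpose acts
   last and kills the image, which still lies in [W]. *)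
have /invariant_subspaceP /(_ x xW) :
    invariant_subspace (\prod_(pq <- w) (A ^+ pq.1 * B ^+ pq.2))^T W.
  apply: (big_ind (fun K : 'M[R]_N => invariant_subspace K^T W)).
  - exact: invariant_subspace_tr1.
  - by move=> K L; exact: invariant_subspace_trM.
  - by move=> pq _; apply: invariant_subspace_trM; exact: invariant_subspace_trX.
by move=> /WD; rewrite mem_kerv mulmxA -trmx_mul => /eqP.
Qed.
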